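(* Let $p,q$ be coprime positive integers with $\frac12\le \frac pq<1$, let $n\ge 1$ be an integer, and let $a_i^-\le a_i^+$ ($i=0,1,\ldots,n$) be real numbers with $0\notin[a_n^-,a_n^+]$. Let $$\mathbf K=\Big\{f(s)=a_0+a_1s+\cdots+a_ns^n \;\Big|\; a_i\in[a_i^-,a_i^+],\ i=0,1,\ldots,n\Big\}$$ and $$D=\Big\{\rho e^{j\theta}\;\Big|\;\rho>0,\ \frac{p\pi}{q}<\theta<2\pi-\frac{p\pi}{q}\Big\}\subset\mathbb C,\qquad j=\sqrt{-1}.$$ Define the circular sign sequence $c:\mathbb Z/2q\mathbb Z\to\{+,-\}$ by $c(k)=+$ for $k=0,1,\ldots,q-1$ and $c(k)=-$ for $k=q,q+1,\ldots,2q-1$. For each starting point $m\in\{0,1,\ldots,2q-1\}$ let $$f_m(s)=\sum_{i=0}^{n}a_i^{\,c(m+ip)}\,s^i,$$ where $m+ip$ is taken modulo $2q$. Then $f_0,f_1,\ldots,f_{2q-1}$ are the critical vertices for left-sector stability of $\mathbf K$; that is, every polynomial in $\mathbf K$ has all its roots in $D$ if and only if each of the $2q$ vertex polynomials $f_0,f_1,\ldots,f_{2q-1}$ has all its roots in $D$.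
   Context: A vertex polynomial of $\mathbf K$ is a polynomial $a_0+a_1s+\cdots+a_ns^n$ with $a_i\in\{a_i^-,a_i^+\}$ for every $i$. Its superscript is the sign vector in $\{+,-\}^{n+1}$ recording, for each $i=0,\ldots,n$, whether $a_i=a_i^-$ or $a_i=a_i^+$. The notation $a_i^{\,c}$ with $c\in\{+,-\}$ means $a_i^+$ or $a_i^-$ accordingly. The polynomials $f_m$ are those produced by the following procedure. Place $q$ consecutive signs $+$ and then $q$ consecutive signs $-$ around a circle. Choose one of the $2q$ signs as the starting point. Its sign is the superscript of $a_0$. Then move around the circle $n$ times with step length $p$, the sign reached after $i$ steps being the superscript of $a_i$. Repeat for every starting point. For small $n$ some of the $2q$ polynomials $f_m$ may coincide. The ''critical vertices for left-sector stability'' are the $2q$ prespecified vertex polynomials of $\mathbf K$ such that all polynomials in $\mathbf K$ have all their roots in $D$ if and only if these $2q$ vertex polynomials have all their roots in $D$. *)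

(* Defs.v *)
From mathcomp Require Import all_boot all_order all_algebra.
From mathcomp Require Import complex.
From mathcomp Require Import all_classical all_reals trigo.

Set Implicit Arguments.
Unset Strict Implicit.
Unset Printing Implicit Defensive.

Import Order.TTheory GRing.Theory Num.Theory.

Local Open Scope classical_set_scope.
Local Open Scope ring_scope.

Definition left_sector (R : realType) (p q : nat) : set R[i] :=
  [set z | exists rho theta : R,
     [/\ 0 < rho,
         p%:R * pi / q%:R < theta < 2 * pi - p%:R * pi / q%:R &
         z = (rho%:C * (cos theta +i* sin theta))%C]].

(* [f] has real coefficients but its roots are taken in the complex plane. *)
Definition all_roots_in (R : realType) (D : set R[i]) (f : {poly R}) : Prop :=
  forall z : R[i], root (map_poly (real_complex R) f) z -> D z.

Definition poly_of_coefs (R : realType) (n : nat) (a : 'I_n.+1 -> R) :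
  {poly R} := \sum_(i < n.+1) a i *: 'X^i.

Definition interval_polys (R : realType) (n : nat) (lo hi : 'I_n.+1 -> R) :
  set {poly R} :=
  [set poly_of_coefs a | a in [set a | forall i, a i \in `[lo i, hi i]]].

(* Signs are booleans, [true] standing for [+]. *)
Definition vertex_poly (R : realType) (n : nat) (lo hi : 'I_n.+1 -> R)
  (c : 'I_n.+1 -> bool) : {poly R} :=
  poly_of_coefs (fun i => if c i then hi i else lo i).

(* The circular sign sequence on Z/2q, as a 2q-periodic function on [nat]. *)
Definition circ_sign (q k : nat) : bool := (k %% (2 * q) < q)%N.

Definition circ_vertex (R : realType) (n : nat) (lo hi : 'I_n.+1 -> R)
  (p q : nat) (m : 'I_(2 * q)) : {poly R} :=
  vertex_poly lo hi (fun i => circ_sign q (m + i * p)%N).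

Definition critical_vertices (R : realType) (D : set R[i]) (n : nat)
  (lo hi : 'I_n.+1 -> R) (N : nat) (v : 'I_N -> {poly R}) : Prop :=
  (forall m, exists c, v m = vertex_poly lo hi c) /\
  ((forall f, interval_polys lo hi f -> all_roots_in D f) <->
   (forall m, all_roots_in D (v m))).

(* Main.v *)
Require Import Defs.
From mathcomp Require Import all_boot all_order all_algebra.
From mathcomp Require Import complex polyrcf.
From mathcomp Require Import all_classical all_reals trigo.
From mathcomp Require Import topology normedtype derive ring lra zify.

Import Order.TTheory GRing.Theory Num.Theory.
Import numFieldNormedType.Exports.

Local Open Scope classical_set_scope.
Local Open Scope ring_scope.

(** Let [u = cis (p pi / q)].  On a boundary ray [rho * u] of the sector the
    values of the box form a convex polygon whose edge directions, multiples of
    [pi / q], do not depend on [rho], and whose vertices in cyclic order are the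
    values of [f_0, ..., f_(2q-1)].  If the polygon ever contained [0], then,
    since it does not at [rho = 0], for some [rho > 0] the origin would lie on
    the edge joining the values of some [f_m] and [f_(m+1)].  The phases of these
    two stable polynomials both increase with [rho], although they have the same
    component normal to the edge and lie on opposite sides of [0]: a
    contradiction.  So no polynomial of the box has a root on the boundary, and
    moving along a segment from a stable vertex to any polynomial of the box no
    root can leave the open sector. *)

Local Notation Re := complex.Re.
Local Notation Im := complex.Im.
Local Notation normc := ComplexField.Normc.normc.

(** * Connectedness of a real segment *)

(** A nonempty subset of a segment that is relatively open and closed is the whole segment. This
    serves both the root homotopy and the search for a first contact with zero. *)
Lemma segment_clopen_ind {R : realType} (a b : R) (P : R -> Prop) :
  (exists2 x, x \in `[a, b] & P x) ->
  (forall x, x \in `[a, b] -> P x ->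
     \forall y \near x, y \in `[a, b] -> P y) ->
  (forall x, x \in `[a, b] -> ~ P x ->
     \forall y \near x, y \in `[a, b] -> ~ P y) ->
  forall x, x \in `[a, b] -> P x.
Proof.
move=> [x0 abx0 Px0] oP oNP.
pose S := [set` `[a, b]].
have SE : S `&` P = S.
  apply: (@segment_connected R a b).
  - by exists x0.
  - exists ([set x | S x -> P x]°); first exact: open_interior.
    apply/seteqP; split => x [Sx Px]; split => //.
      exact: oP.
    exact: (interior_subset Px).
  - exists (~` [set x | S x -> ~ P x]°).
      exact/open_closedC/open_interior.
    apply/seteqP; split => x [Sx Px]; split => //.
      by move=> /interior_subset /(_ Sx); apply.
    by apply: contrapT => nPx; apply: Px; exact: oNP.
by move=> x abx; have : S x by []; rewrite -SE => -[].
Qed.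

(** * Real and imaginary parts, modulus, and points of the unit circle *)

Section ComplexParts.
Context {R : realType}.
Implicit Types (x y z w : R[i]) (a t : R).

Lemma Re_mul z w : Re (z * w) = Re z * Re w - Im z * Im w.
Proof. by case: z w => ? ? [? ?]. Qed.

Lemma Im_mul z w : Im (z * w) = Re z * Im w + Im z * Re w.
Proof. by case: z w => ? ? [? ?]. Qed.

Lemma Re_add z w : Re (z + w) = Re z + Re w. Proof. by case: z w => ? ? [? ?]. Qed.
Lemma Im_add z w : Im (z + w) = Im z + Im w. Proof. by case: z w => ? ? [? ?]. Qed.
Lemma Re_opp z : Re (- z) = - Re z. Proof. by case: z. Qed.
Lemma Im_opp z : Im (- z) = - Im z. Proof. by case: z. Qed.
Lemma Re_conjc z : Re z^*%C = Re z. Proof. by case: z. Qed.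
Lemma Im_conjc z : Im z^*%C = - Im z. Proof. by case: z. Qed.

Definition complex_partE := 
  (Re_mul, Im_mul, Re_add, Im_add, Re_opp, Im_opp, Re_conjc, Im_conjc).

Lemma complex_eq z w : Re z = Re w -> Im z = Im w -> z = w.
Proof. by case: z w => ? ? [? ?] /= -> ->. Qed.

Lemma normc_sqrtE z : normc z = Num.sqrt (Re z ^+ 2 + Im z ^+ 2).
Proof. by case: z. Qed.

Lemma normc_ge0 z : 0 <= normc z.
Proof. by rewrite normc_sqrtE sqrtr_ge0. Qed.

Lemma normc_triangle z w : normc (z + w) <= normc z + normc w.
Proof. exact: (@le_normcD R z w). Qed.

Lemma normcB z w : normc (z - w) = normc (w - z).
Proof. by rewrite !normc_sqrtE !complex_partE; congr Num.sqrt; ring. Qed.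

Lemma normc_real a : normc a%:C%C = `|a|.
Proof. by rewrite normc_sqrtE /= expr0n addr0 sqrtr_sqr. Qed.

Lemma normcX z n : normc (z ^+ n) = normc z ^+ n.
Proof.
elim: n => [|n IHn]; first by rewrite !expr0 ComplexField.Normc.normc1.
by rewrite !exprS ComplexField.Normc.normcM IHn.
Qed.

Lemma normc_sum (I : Type) (r : seq I) (F : I -> R[i]) :
  normc (\sum_(i <- r) F i) <= \sum_(i <- r) normc (F i).
Proof.
elim/big_ind2 : _ => [|z u w v zu wv|//]; first by rewrite ComplexField.Normc.normc0.
exact: le_trans (normc_triangle _ _) (lerD zu wv).
Qed.

Lemma conjc_scale a z : (a%:C%C * z)^*%C = a%:C%C * z^*%C.
Proof. by apply: complex_eq; rewrite !complex_partE /=; ring. Qed.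

Definition cis t : R[i] := (cos t +i* sin t)%C.

Lemma cisD t a : cis (t + a) = cis t * cis a.
Proof. by apply: complex_eq; rewrite !complex_partE /= ?cosD ?sinD //; ring. Qed.

Lemma cis0 : cis 0 = 1.
Proof. by rewrite /cis cos0 sin0. Qed.

Lemma cisX t n : cis t ^+ n = cis (t *+ n).
Proof.
elim: n => [|n IHn]; first by rewrite expr0 mulr0n cis0.
by rewrite exprS mulrS cisD IHn.
Qed.

End ComplexParts.

(** * The sector as an intersection of two half-planes *)

Section RaySide.
Context {R : realType}.
Implicit Types (z w : R[i]) (t : R).

(* [Im (z * cis (- t))]: positive to the left of the ray of angle [t]. *)
Definition ray_side t z : R := cos t * Im z - sin t * Re z.

Lemma ray_sideB t z w : ray_side t (z - w) = ray_side t z - ray_side t w.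
Proof. by rewrite /ray_side !complex_partE; ring. Qed.

(** Cauchy-Schwarz: [ray_side t z] is one coordinate of [z] in an orthonormal frame, and the gap
    between the squares is the square of the other coordinate. *)
Lemma ray_side_le t z : `|ray_side t z| <= normc z.
Proof.
rewrite normc_sqrtE -sqrtr_sqr ler_wsqrtr // /ray_side.
have := cos2Dsin2 t; set c := cos t; set s := sin t => cs.
rewrite -[leRHS]mul1r -cs -subr_ge0.
set A := _ - _; suff -> : A = (c * Re z + s * Im z) ^+ 2 by exact: sqr_ge0.
by rewrite /A; ring.
Qed.

Lemma ray_side_cis t (r a : R) : ray_side t (r%:C%C * cis a) = r * sin (a - t).
Proof. by rewrite /ray_side !complex_partE /= sinB; ring. Qed.

Lemma polar_form_upper z : 0 <= Im z -> z != 0 ->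
  exists r a : R, [/\ 0 < r, 0 <= a <= pi & z = r%:C%C * cis a].
Proof.
move=> Imz z0.
have r0 : 0 < normc z.
  rewrite lt_def normc_ge0 andbT.
  by apply: contra z0 => /eqP/ComplexField.Normc.eq0_normc ->.
have rE : normc z ^+ 2 = Re z ^+ 2 + Im z ^+ 2.
  by rewrite normc_sqrtE sqr_sqrtr // addr_ge0 ?sqr_ge0.
set r := normc z in r0 rE.
have rx : -1 <= Re z / r <= 1.
  rewrite -ler_norml normrM normfV (gtr0_norm r0) ler_pdivrMr // mul1r.
  by rewrite -(ger0_norm (ltW r0)) -ler_sqr ?nnegrE //
     !real_normK ?num_real // rE lerDl sqr_ge0.
exists r, (acos (Re z / r)); split => //; first by rewrite acos_ge0 ?acos_lepi.
have r1 : r != 0 by rewrite gt_eqF.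
apply: complex_eq; rewrite !complex_partE /= ?mul0r ?subr0 ?addr0.
  by rewrite acosK ?in_itv //= mulrC divfK.
rewrite sin_acos // -[in LHS](ger0_norm Imz) -sqrtr_sqr.
rewrite -[X in X * Num.sqrt _](ger0_norm (ltW r0)) -[`|r|]sqrtr_sqr -sqrtrM ?sqr_ge0 //.
by congr Num.sqrt; rewrite mulrBr mulr1 exprMn exprVn mulrC divfK ?sqrf_eq0 // rE; ring.
Qed.

Lemma cisN_conj t : cis (2 * pi - t) = (cis t)^*%C :> R[i].
Proof.
have -> : 2 * pi - t = - t + pi *+ 2 :> R by rewrite mulr_natl addrC.
by apply: complex_eq; rewrite !complex_partE /= ?cosD2pi ?sinD2pi ?cosN ?sinN.
Qed.

Lemma ray_side_conj_cis t (r a : R) :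
  ray_side t (r%:C%C * cis a)^*%C = r * sin (2 * pi - a - t).
Proof. by rewrite conjc_scale -cisN_conj ray_side_cis. Qed.

(** For [pi / 2 <= t] the opening [2 * pi - 2 * t] is at most [pi], so the sector is convex and cut
    out by its two boundary lines, which conjugation exchanges. Points below the real axis are
    reduced to their conjugates. *)
Lemma sector_ray_sides t z : pi / 2 <= t < pi ->
  (exists r a : R, [/\ 0 < r, t < a < 2 * pi - t & z = r%:C%C * cis a]) <->
  0 < ray_side t z /\ 0 < ray_side t z^*%C.
Proof.
move=> /andP[t1 t2]; have pi0 := pi_gt0 R; split.
  move=> [r [a [r0 /andP[a1 a2] ->]]].
  rewrite ray_side_cis ray_side_conj_cis !pmulr_rgt0 //.
  by split; apply: sin_gt0_pi; apply/andP; split; lra.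
have upper w : 0 <= Im w -> 0 < ray_side t w -> exists r a : R,
    [/\ 0 < r, t < a < 2 * pi - t & w = r%:C%C * cis a].
  move=> Imw w1; have w0 : w != 0.
    by apply: contraTneq w1 => ->; rewrite /ray_side /= !mulr0 subr0 ltxx.
  have [r [a [r0 /andP[a0 api] wE]]] := polar_form_upper _ Imw w0.
  exists r, a; split => //; move: w1; rewrite wE ray_side_cis pmulr_rgt0 // => w1.
  apply/andP; split; last lra.
  rewrite ltNge; apply/negP => at_.
  have : 0 <= sin (t - a) by apply: sin_ge0_pi; apply/andP; split; lra.
  by rewrite -opprB sinN; lra.
move=> [z1 z2]; have [Imz|Imz] := leP 0 (Im z); first exact: upper.
have [||r [a [r0 /andP[a1 a2] zE]]] := upper z^*%C => //.
  by rewrite complex_partE; lra.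
exists r, (2 * pi - a); split => //; first by apply/andP; split; lra.
by rewrite cisN_conj -[z]conjcK zE conjc_scale.
Qed.

End RaySide.

(** * Factorization over the roots: phase along a ray and lower bounds on the modulus *)

Section Factorization.
Context {R : realType}.
Implicit Types (D : set R[i]) (f : {poly R}) (z r : R[i]) (rs : seq R[i]).

Definition from_roots rs : {poly R[i]} := \prod_(r <- rs) ('X - r%:P).

Lemma from_roots_cons r rs : from_roots (r :: rs) = ('X - r%:P) * from_roots rs.
Proof. exact: big_cons. Qed.

Lemma all_roots_in_factor D f : f != 0 -> all_roots_in D f ->
  exists rs, [/\ size rs = (size f).-1, {in rs, forall r, D r} &
    map_poly (real_complex R) f = (lead_coef f)%:C%C *: from_roots rs].
Proof.
move=> f0 fD; set F := map_poly _ f.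
have [rs FE] := closed_field_poly_normal F; rewrite lead_coef_map in FE.
have l0 : (lead_coef f)%:C%C != 0 :> R[i] by rewrite fmorph_eq0 lead_coef_eq0.
exists rs; split => //.
  by rewrite -(size_map_poly (real_complex R) f) -/F FE size_scale // size_prod_XsubC.
by move=> r rrs; apply: fD; rewrite -/F FE rootZ // root_prod_XsubC.
Qed.

(* [d arg F] along the ray is the sum of the contributions of the roots; only
   the sign of [Im (F' / F) = Im (F' * F^* ) / |F| ^ 2] matters. *)
Lemma phase_from_roots (t rho : R) rs :
  {in rs, forall r, 0 < ray_side t r} ->
  let z := rho%:C%C * cis t in
  (from_roots rs).[z] != 0 /\
  let v := Im (cis t * (from_roots rs)^`().[z] * (from_roots rs).[z]^*%C) in
  0 <= v /\ (rs <> [::] -> 0 < v).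
Proof.
move=> + z; elim: rs => [_|r rs IH rsD].
  by rewrite /from_roots big_nil derivC !hornerE oner_eq0.
have rD : 0 < ray_side t r by apply: rsD; rewrite mem_head.
have [|F0 [v0 _]] := IH; first by move=> s srs; apply: rsD; rewrite inE srs orbT.
rewrite from_roots_cons; set F := from_roots rs in F0 v0 *.
rewrite derivM derivB derivX derivC subr0 mul1r !hornerE.
have zr : Im (cis t * (z - r)^*%C) = ray_side t r.
  by rewrite /ray_side /z !complex_partE /=; ring.
have zr0 : z - r != 0.
  by apply: contraTneq rD => zr0; rewrite -zr zr0 /= mulr0 oppr0 mulr0 addr0 ltxx.
split; first by rewrite mulf_neq0.
set G := F.[z] in F0 v0 *; set G' := _.[z] in v0 *.
have sq_gt0 (w : R[i]) : w != 0 -> 0 < Re w ^+ 2 + Im w ^+ 2.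
  move=> w0; rewrite lt0r addr_ge0 ?sqr_ge0 ?andbT //.
  rewrite paddr_eq0 ?sqr_ge0 //.
  rewrite !sqrf_eq0; apply: contra w0 => /andP[/eqP a /eqP b].
  apply/eqP; exact: complex_eq.
move=> v; suff vp : 0 < v by split; [exact: ltW|].
(* The logarithmic derivative of a product is a sum; this is that identity cleared of denominators
   by the squared moduli of [G] and [z - r]. *)
have -> : v = (Re G ^+ 2 + Im G ^+ 2) * Im (cis t * (z - r)^*%C) +
    (Re (z - r) ^+ 2 + Im (z - r) ^+ 2) * Im (cis t * G' * G^*%C).
  by rewrite /v; move: (cis t) (z - r) => u w; rewrite !complex_partE; ring.
by rewrite zr ltr_pwDl ?mulr_gt0 ?mulr_ge0 ?sq_gt0 // ltW ?sq_gt0.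
Qed.

(** The leading coefficient is real and enters only through the positive factor [l ^+ 2]; the size
    condition supplies a root, hence strictness. *)
Lemma phase_increasing (t rho : R) f : (1 < size f)%N ->
  all_roots_in [set r | 0 < ray_side t r] f ->
  let F := map_poly (real_complex R) f in
  let z := rho%:C%C * cis t in
  F.[z] != 0 /\ 0 < Im (cis t * F^`().[z] * F.[z]^*%C).
Proof.
move=> fs fD F z; have f0 : f != 0 by rewrite -size_poly_gt0 (ltn_trans _ fs).
have [rs [rs_size rsD FE]] := all_roots_in_factor _ _ f0 fD.
have [G0 [_ vG]] := phase_from_roots t rho rs rsD.
have rs0 : rs <> [::] by move=> rsE; move: rs_size fs; rewrite rsE; case: (size f) => [|[]].
move: {vG} G0 (vG rs0); rewrite /F FE derivZ !hornerZ -/z => G0 vG.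
have l0 : lead_coef f != 0 by rewrite lead_coef_eq0.
split; first by rewrite mulf_neq0 // fmorph_eq0.
have ImZ (l : R) (a b c : R[i]) :
    Im (a * (l%:C%C * b) * (l%:C%C * c)) = l ^+ 2 * Im (a * b * c).
  by rewrite !complex_partE /=; ring.
by rewrite conjc_scale ImZ mulr_gt0 // exprn_even_gt0.
Qed.

Lemma from_roots_ge_dist rs z (d : R) : 0 <= d ->
  {in rs, forall r, d <= normc (z - r)} ->
  d ^+ size rs <= normc (from_roots rs).[z].
Proof.
move=> d0; elim: rs => [_|r rs IH rsD].
  by rewrite /from_roots big_nil hornerE ComplexField.Normc.normc1.
rewrite from_roots_cons hornerM ComplexField.Normc.normcM hornerXsubC exprS.
apply: ler_pM; rewrite ?exprn_ge0 //; first by apply: rsD; rewrite mem_head.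
by apply: IH => s srs; apply: rsD; rewrite inE srs orbT.
Qed.

(** The bound grows with the full degree, so that on an unbounded set [A] it can dominate a small
    perturbation of all the coefficients uniformly in [z]. *)
Lemma from_roots_ge_growth rs (A : set R[i]) :
  {in rs, forall r, exists2 k, 0 < k &
     forall z, A z -> k * (1 + normc z) <= normc (z - r)} ->
  exists2 k, 0 < k &
    forall z, A z -> k * (1 + normc z) ^+ size rs <= normc (from_roots rs).[z].
Proof.
elim: rs => [_|r rs IH rsD].
  by exists 1 => // z _; rewrite /from_roots big_nil !hornerE ComplexField.Normc.normc1.
have [k k0 kP] := rsD r (mem_head _ _).
have [|l l0 lP] := IH; first by move=> s srs; apply: rsD; rewrite inE srs orbT.
exists (k * l); rewrite ?mulr_gt0 // => z Az.
rewrite from_roots_cons hornerM ComplexField.Normc.normcM hornerXsubC exprS mulrACA.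
have z0 : 0 <= 1 + normc z by rewrite addr_ge0 ?normc_ge0.
by apply: ler_pM; rewrite ?kP ?lP ?mulr_ge0 ?exprn_ge0 // ltW.
Qed.

(** The constant comes from adding [1 <= normc (z - r) / d] to the triangle inequality for
    [normc z], with [normc r] absorbed by the same quotient. *)
Lemma growth_of_dist z r (d : R) : 0 < d -> d <= normc (z - r) ->
  (1 + d^-1 + normc r / d)^-1 * (1 + normc z) <= normc (z - r).
Proof.
move=> d0 dzr; have r0 := normc_ge0 r.
have d1 : 0 < d^-1 by rewrite invr_gt0.
have rd : 0 <= normc r / d by rewrite divr_ge0 // ltW.
rewrite mulrC ler_pdivrMr; last by rewrite ltr_wpDr // addr_gt0.
have zE : normc z <= normc (z - r) + normc r.
  by rewrite -[X in normc X <= _](subrK r); exact: normc_triangle.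
have h1 : 1 <= normc (z - r) / d by rewrite ler_pdivlMr // mul1r.
have h2 : normc r <= normc (z - r) / d * normc r by rewrite ler_peMl.
by rewrite !mulrDr mulr1 [_ * (_ / _)]mulrA [_ * normc r]mulrC; lra.
Qed.

End Factorization.

(** * Polynomials given by their coefficients, and their perturbation *)

Section CoefPolynomials.
Context {R : realType} {n : nat}.
Implicit Types (a b : 'I_n.+1 -> R) (z : R[i]).

Lemma coef_poly_of_coefs a (i : 'I_n.+1) : (poly_of_coefs a)`_i = a i.
Proof.
rewrite /poly_of_coefs coef_sum (bigD1 i) //= coefZ coefXn eqxx mulr1 big1 ?addr0 //.
by move=> j ji; rewrite coefZ coefXn val_eqE eq_sym (negbTE ji) mulr0.
Qed.

Lemma size_poly_of_coefs a : a ord_max != 0 -> size (poly_of_coefs a) = n.+1.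
Proof.
move=> a0; apply/eqP; rewrite eqn_leq; apply/andP; split; last first.
  by apply: contraR a0; rewrite -leqNgt -(coef_poly_of_coefs a ord_max) => /(nth_default 0) ->.
rewrite (leq_trans (size_sum _ _ _)) //; apply/bigmax_leqP => i _.
by rewrite (leq_trans (size_scale_leq _ _)) // size_polyXn.
Qed.

Lemma lead_coef_poly_of_coefs a :
  a ord_max != 0 -> lead_coef (poly_of_coefs a) = a ord_max.
Proof.
by move=> a0; rewrite lead_coefE size_poly_of_coefs //= -(coef_poly_of_coefs a ord_max).
Qed.

Lemma map_poly_of_coefs a : map_poly (real_complex R) (poly_of_coefs a) =
  \sum_(i < n.+1) (a i)%:C%C *: 'X^i.
Proof.
by rewrite rmorph_sum /=; apply: eq_bigr => i _; rewrite map_polyZ /= map_polyXn.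
Qed.

Lemma horner_map_poly_of_coefs a z :
  (map_poly (real_complex R) (poly_of_coefs a)).[z] =
  \sum_(i < n.+1) (a i)%:C%C * z ^+ i.
Proof.
by rewrite map_poly_of_coefs horner_sum; apply: eq_bigr => i _; rewrite hornerZ hornerXn.
Qed.

Lemma poly_of_coefs_homotopy_dist a b (x y : R) z
  (f := fun t : R => map_poly (real_complex R)
     (poly_of_coefs (fun i => (1 - t) * b i + t * a i))) :
  normc ((f x).[z] - (f y).[z]) <=
  `|x - y| * ((\sum_(i < n.+1) `|a i - b i|) * (1 + normc z) ^+ n).
Proof.
rewrite /f !horner_map_poly_of_coefs -sumrB.
apply: le_trans (normc_sum _ _ _) _; rewrite mulr_suml mulr_sumr.
apply: ler_sum => i _.
have -> : ((1 - x) * b i + x * a i)%:C%C * z ^+ i -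
    ((1 - y) * b i + y * a i)%:C%C * z ^+ i = ((x - y) * (a i - b i))%:C%C * z ^+ i.
  by rewrite -mulrBl -rmorphB /=; congr ((_)%:C%C * _); ring.
rewrite ComplexField.Normc.normcM normc_real normrM normcX -mulrA.
do 2 rewrite ler_wpM2l //; have z0 := normc_ge0 z.
have z1 : 1 <= 1 + normc z by lra.
apply: (@le_trans _ _ ((1 + normc z) ^+ i)); last by rewrite ler_weXn2l // -ltnS.
by rewrite lerXn2r ?nnegrE //; lra.
Qed.

End CoefPolynomials.

(** * Roots cannot leave the sector without crossing its boundary *)

Section Homotopy.
Context {R : realType} (t : R).
Implicit Types (z r : R[i]).

Definition sector : set R[i] :=
  [set z | 0 < ray_side t z /\ 0 < ray_side t z^*%C].

Lemma sector_complement z : ~ sector z -> ray_side t z <= 0 \/ ray_side t z^*%C <= 0.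
Proof.
move=> zS; have [?|z1] := leP (ray_side t z) 0; first by left.
by right; rewrite leNgt; apply/negP => z2; apply: zS.
Qed.

Lemma ray_side_dist z r :
  ray_side t r - ray_side t z <= normc (z - r) /\
  ray_side t r^*%C - ray_side t z^*%C <= normc (z - r).
Proof.
have conjE : normc (r^*%C - z^*%C) = normc (z - r).
  by rewrite !normc_sqrtE !complex_partE; congr Num.sqrt; ring.
rewrite -!ray_sideB; split.
  by rewrite normcB; exact: le_trans (ler_norm _) (ray_side_le _ _).
by rewrite -conjE; exact: le_trans (ler_norm _) (ray_side_le _ _).
Qed.

Lemma sector_growth r : sector r ->
  exists2 k, 0 < k &
    forall z, (~` sector) z -> k * (1 + normc z) <= normc (z - r).
Proof.
move=> [r1 r2]; pose d := Num.min (ray_side t r) (ray_side t r^*%C).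
have d0 : 0 < d by rewrite lt_min r1.
have [d1 d2] : d <= ray_side t r /\ d <= ray_side t r^*%C.
  by rewrite !ge_min !lexx orbT.
exists (1 + d^-1 + normc r / d)^-1.
  have r0 : 0 <= normc r / d by rewrite divr_ge0 ?normc_ge0 // ltW.
  by rewrite invr_gt0 ltr_wpDr // addr_gt0 // invr_gt0.
move=> z /sector_complement zS; apply: growth_of_dist => //.
by have [s1 s2] := ray_side_dist z r; case: zS; lra.
Qed.

(** Continuity of roots without following individual roots: the parameters with all roots in the
    sector form a relatively open and closed set. The bound [lam] keeps the degree constant, so no
    root passes through infinity. *)
Lemma all_roots_in_homotopy (n : nat) (a b : 'I_n.+1 -> R) (lam : R) :
  let c (x : R) i := (1 - x) * b i + x * a i in
  0 < lam ->
  (forall x, x \in `[0, 1] -> lam <= `|c x ord_max|) ->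
  (forall x z, x \in `[0, 1] ->
     root (map_poly (real_complex R) (poly_of_coefs (c x))) z ->
     0 <= ray_side t z -> 0 <= ray_side t z^*%C -> sector z) ->
  all_roots_in sector (poly_of_coefs b) -> all_roots_in sector (poly_of_coefs a).
Proof.
move=> c lam0 c_lead c_bd b_in.
pose F x := map_poly (real_complex R) (poly_of_coefs (c x)).
pose M := \sum_(i < n.+1) `|a i - b i|.
have M0 : 0 <= M by rewrite sumr_ge0.
have Fdist x y z : normc ((F x).[z] - (F y).[z]) <= `|x - y| * (M * (1 + normc z) ^+ n).
  exact: poly_of_coefs_homotopy_dist.
have c0 x : x \in `[0, 1] -> c x ord_max != 0.
  by move=> x01; rewrite -normr_gt0 (lt_le_trans lam0) // c_lead.
have Ffact x : x \in `[0, 1] -> all_roots_in sector (poly_of_coefs (c x)) ->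
    exists rs, [/\ size rs = n, {in rs, forall r, sector r} &
      F x = (c x ord_max)%:C%C *: from_roots rs].
  move=> x01 xin; have := all_roots_in_factor _ _ _ xin.
  rewrite -size_poly_gt0 size_poly_of_coefs ?c0 // lead_coef_poly_of_coefs ?c0 //.
  exact.
suff /(_ 1) : forall x, x \in `[0, 1] -> all_roots_in sector (poly_of_coefs (c x)).
  rewrite in_itv /= lexx ler01 => /(_ isT).
  by congr (all_roots_in _ (poly_of_coefs _)); apply/funext => i; rewrite /c; ring.
apply: segment_clopen_ind.
- exists 0; first by rewrite in_itv /= lexx ler01.
  move: b_in; congr (all_roots_in _ (poly_of_coefs _)).
  by apply/funext => i; rewrite /c; ring.
(* Openness: outside the sector the modulus of [F x] is at least [lam * k * (1 + normc z) ^+ n],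
   more than the perturbation for [y] near [x]. *)
- move=> x x01 xin; have [rs [rs_size rsD FE]] := Ffact x x01 xin.
  have [|k k0 kP] := from_roots_ge_growth rs (~` sector).
    by move=> r rrs; apply: sector_growth; exact: rsD.
  (* [M] vanishes when [a = b], hence the [+ 1]. *)
  have e0 : 0 < lam * k / (M + 1).
    by rewrite divr_gt0 ?mulr_gt0 // ltr_wpDl.
  near=> y; move=> y01 z /rootP zy; apply: contrapT => zS.
  have xy : `|x - y| < lam * k / (M + 1) by near: y; exact: nbhsx_ballx.
  have := Fdist x y z; rewrite -/(F y) in zy; rewrite zy subr0 FE hornerZ.
  rewrite ComplexField.Normc.normcM normc_real.
  have zn : 0 < (1 + normc z) ^+ n by rewrite exprn_gt0 // ltr_wpDr ?normc_ge0.
  have := kP z zS; rewrite rs_size; set u := normc _ => ku.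
  apply/negP; rewrite -ltNge.
  have u0 : 0 <= u by exact: normc_ge0.
  apply: (@lt_le_trans _ _ (lam * (k * (1 + normc z) ^+ n))); last first.
    by apply: ler_pM; rewrite ?c_lead // ?mulr_ge0 // ltW.
  rewrite !mulrA ltr_pM2r //.
  move: xy; rewrite ltr_pdivlMr ?ltr_wpDl //; apply: le_lt_trans.
  by rewrite ler_wpM2l //; lra.
(* Closedness: by [c_bd], a root [z] of [F x] outside the sector violates one of its inequalities
   strictly, so it lies at some distance [d] from the sector. A stable [F y] would have modulus at
   least [lam * d ^+ n] at [z], too far from zero for [y] near [x]. *)
- move=> x x01 xnin.
  have [z zx zS] : exists2 z, root (F x) z & ~ sector z.
    apply: contrapT => h; apply: xnin => z zx; apply: contrapT => zS.
    by apply: h; exists z.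
  have [d d0 dP] : exists2 d, 0 < d & forall r, sector r -> d <= normc (z - r).
    have [z1|z1] := ltP (ray_side t z) 0.
      exists (- ray_side t z); first by rewrite oppr_gt0.
      by move=> r [r1 r2]; have [] := ray_side_dist z r; lra.
    have [z2|z2] := ltP (ray_side t z^*%C) 0.
      exists (- ray_side t z^*%C); first by rewrite oppr_gt0.
      by move=> r [r1 r2]; have [] := ray_side_dist z r; lra.
    by case: zS; exact: c_bd zx z1 z2.
  have zn : 0 < (1 + normc z) ^+ n by rewrite exprn_gt0 // ltr_wpDr ?normc_ge0.
  pose m := M * (1 + normc z) ^+ n.
  have m0 : 0 <= m by rewrite mulr_ge0 // ltW.
  have e0 : 0 < lam * d ^+ n / (m + 1).
    by rewrite divr_gt0 ?mulr_gt0 ?exprn_gt0 // ltr_wpDl.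
  near=> y; move=> y01 yin.
  have xy : `|x - y| < lam * d ^+ n / (m + 1) by near: y; exact: nbhsx_ballx.
  have [rs [rs_size rsD FE]] := Ffact y y01 yin.
  have := Fdist y x z; rewrite (rootP zx) subr0 FE hornerZ distrC.
  rewrite ComplexField.Normc.normcM normc_real -/m.
  apply/negP; rewrite -ltNge.
  apply: (@lt_le_trans _ _ (lam * d ^+ n)); last first.
    have d1 := ltW d0; have lam1 := ltW lam0.
    apply: ler_pM; rewrite ?c_lead ?exprn_ge0 // -rs_size.
    by apply: from_roots_ge_dist => // r /rsD /dP.
  move: xy; rewrite ltr_pdivlMr ?ltr_wpDl //; apply: le_lt_trans.
  by rewrite ler_wpM2l //; lra.
Unshelve. all: by end_near. Qed.

End Homotopy.

(** * Contact of a finite family of polynomials with zero *)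

(** Without contact, joint nonnegativity would be strict wherever it holds, hence open as well as
    closed, and would spread from [b] down to [x0]. *)
Lemma poly_touch_zero {R : realType} (N : nat) (h : 'I_N -> {poly R}) (x0 b : R) :
  x0 <= b -> (forall j, 0 <= (h j).[b]) -> (exists j, (h j).[x0] < 0) ->
  exists x, [/\ x0 <= x, forall j, 0 <= (h j).[x] & exists j, (h j).[x] = 0].
Proof.
move=> x0b hb [i hi0]; apply: contrapT => notouch.
have : forall x, x \in `[x0, b] -> forall j, 0 <= (h j).[x].
  apply: segment_clopen_ind.
  - by exists b => //; rewrite in_itv /= x0b lexx.
  - move=> x; rewrite in_itv /= => /andP[x0x _] hx.
    have : \forall y \near x, forall j, 0 < (h j).[y].
      apply: (@filter_forall R 'I_N (fun j y => 0 < (h j).[y]) (nbhs x) _) => j.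
      apply: (@cvgr_gt _ _ (nbhs x) _ (horner (h j)) (h j).[x]).
        exact: continuous_horner.
      rewrite lt_neqAle hx andbT eq_sym; apply: contra_notN notouch => /eqP hj.
      by exists x; split => //; exists j.
    by apply: filterS => y hy _ j; exact: ltW.
  - move=> x _ /existsNP[j /negP]; rewrite -ltNge => hj.
    have : \forall y \near x, (h j).[y] < 0.
      apply: (@cvgr_lt _ _ (nbhs x) _ (horner (h j)) (h j).[x]) => //.
      exact: continuous_horner.
    by apply: filterS => y hy _ /(_ j); rewrite leNgt hy.
by move=> /(_ x0); rewrite in_itv /= lexx x0b => /(_ isT i); rewrite leNgt hi0.
Qed.

(** * The circular signs as signs of a sine *)

Section CircularSigns.
Context {R : realType} (q : nat).
Context (q_gt1 : (1 < q)%N).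

Definition ang (k : nat) : R := k%:R * pi / q%:R.

Let q_gt0 : 0 < q%:R :> R. Proof. by rewrite ltr0n ltnW. Qed.
Let q_neq0 : q%:R != 0 :> R. Proof. by rewrite gt_eqF. Qed.

Lemma angD k l : ang (k + l) = ang k + ang l.
Proof. by rewrite /ang natrD !mulrDl. Qed.

Lemma angM_period k l : sin (ang (k + l * (2 * q))) = sin (ang k).
Proof.
rewrite angD /ang !natrM; have -> : l%:R * (2 * q%:R) * pi / q%:R = pi *+ 2 *+ l :> R.
  by rewrite -mulrnA -[RHS]mulr_natl natrM; field.
exact: (periodicn (@sinD2pi R)).
Qed.

Lemma sin_ang_mod k : sin (ang (k %% (2 * q))) = sin (ang k).
Proof. by rewrite [in RHS](divn_eq k (2 * q)) addnC angM_period. Qed.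

Lemma ang_ge0 k : 0 <= ang k.
Proof. by rewrite divr_ge0 ?mulr_ge0 ?pi_ge0 ?ler0n. Qed.

Lemma ang_le_pi k : (k <= q)%N -> ang k <= pi.
Proof. by move=> kq; rewrite ler_pdivrMr // mulrC ler_wpM2l ?pi_ge0 // ler_nat. Qed.

Lemma sin_ang1_gt0 : 0 < sin (ang 1).
Proof.
apply: sin_gt0_pi; rewrite /ang mul1r divr_gt0 ?pi_gt0 //=.
by rewrite ltr_pdivrMr // ltr_pMr ?pi_gt0 // ltr1n.
Qed.

Lemma sin_angDq k : sin (ang (k + q)) = - sin (ang k).
Proof. by rewrite angD [ang q]/ang mulrC mulKf // sinDpi. Qed.

(** With the next lemma: the circular sequence is a sign pattern of the sine at the multiples of
    [pi / q], which is why it selects extremal vertices. *)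
Lemma circ_sign_ge0 k : circ_sign q k -> 0 <= sin (ang k).
Proof.
by move=> kq; rewrite -sin_ang_mod sin_ge0_pi // ang_ge0 ang_le_pi // ltnW.
Qed.

Lemma circ_sign_le0 k : ~~ circ_sign q k -> sin (ang k) <= 0.
Proof.
rewrite /circ_sign -leqNgt -sin_ang_mod => kq.
have k2q : (k %% (2 * q) < 2 * q)%N by rewrite ltn_mod; lia.
rewrite -(subnK kq) sin_angDq oppr_le0 sin_ge0_pi // ang_ge0 ang_le_pi //; lia.
Qed.

(** The sign switches only on reaching a multiple of [q], where the sine vanishes. *)
Lemma circ_sign_step k :
  circ_sign q k != circ_sign q k.+1 -> sin (ang k.+1) = 0.
Proof.
rewrite -(sin_ang_mod k.+1) /circ_sign modnS; case: ifP => [_ _|_ kq].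
  by rewrite /ang mul0r mul0r sin0.
suff -> : (k %% (2 * q)).+1 = q by rewrite /ang mulrC mulKf // sinpi.
by move: kq; case: ltnP; case: ltnP => //; lia.
Qed.

Lemma circ_sign_mod k l : circ_sign q (k %% (2 * q) + l) = circ_sign q (k + l).
Proof. by rewrite /circ_sign modnDml. Qed.

Lemma circ_sign1 : circ_sign q 1.
Proof. by rewrite /circ_sign modn_small; lia. Qed.

Lemma circ_signq1 : circ_sign q q.+1 = false.
Proof. by rewrite /circ_sign modn_small; lia. Qed.

End CircularSigns.

(** * The polygon of values on a boundary ray *)

Section ValuePolygon.
Context {R : realType} (p q n : nat).
Context (q_gt1 : (1 < q)%N).
Implicit Types (a : 'I_n.+1 -> R) (k : nat) (rho : R).

Local Notation theta := (p%:R * pi / q%:R : R).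
Local Notation ang := (@ang R q).
Local Notation cplx a := (map_poly (real_complex R) (poly_of_coefs a)).

(* The polynomial [rho |-> Im (cis (ang k) * f (rho * cis theta))], i.e. the
   component of the value of [f] on the boundary ray in the direction normal to
   the edges of direction [cis (- ang k)]. *)
Definition edge_poly k a : {poly R} :=
  \sum_(i < n.+1) (a i * sin (ang (k + i * p))) *: 'X^i.

(** Since [theta] is [ang p], a step of length [p] on the circle of signs matches one multiplication
    by [cis theta]. *)
Lemma cis_ang k i : cis (ang k) * cis theta ^+ i = cis (ang (k + i * p)).
Proof.
rewrite cisX -cisD angD; congr (cis (_ + _)).
by rewrite -[theta *+ i]mulr_natl /ang natrM !mulrA.
Qed.

Let Im_sum (I : Type) (r : seq I) (G : I -> R[i]) :
  Im (\sum_(i <- r) G i) = \sum_(i <- r) Im (G i).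
Proof. by elim: r => [|x r IH]; rewrite ?big_nil // !big_cons Im_add IH. Qed.

Let Im_scale (x : R) (z : R[i]) : Im (x%:C%C * z) = x * Im z.
Proof. by rewrite Im_mul /= mul0r addr0. Qed.

Lemma horner_edge_poly k a rho :
  (edge_poly k a).[rho] = Im (cis (ang k) * (cplx a).[rho%:C%C * cis theta]).
Proof.
rewrite horner_map_poly_of_coefs mulr_sumr Im_sum horner_sum.
apply: eq_bigr => i _; rewrite hornerZ hornerXn.
have -> : cis (ang k) * ((a i)%:C%C * (rho%:C%C * cis theta) ^+ i) =
    (a i * rho ^+ i)%:C%C * (cis (ang k) * cis theta ^+ i).
  by rewrite exprMn rmorphM rmorphXn /=; ring.
by rewrite cis_ang Im_scale /= mulrAC.
Qed.

Lemma horner_deriv_edge_poly k a rho :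
  (edge_poly k a)^`().[rho] =
  Im (cis (ang k) * (cis theta * (cplx a)^`().[rho%:C%C * cis theta])).
Proof.
rewrite map_poly_of_coefs !raddf_sum /= !horner_sum !mulr_sumr Im_sum.
apply: eq_bigr => -[[|i] ilt] _ /=.
  by rewrite !derivZ !derivXn !mulr0n !scaler0 !horner0 !mulr0.
rewrite !derivZ !derivXn /= !hornerZ !hornerMn !hornerXn.
set A := a _.
have -> : cis (ang k) * (cis theta *
    (A%:C%C * ((rho%:C%C * cis theta) ^+ i *+ i.+1))) =
    (A * (rho ^+ i *+ i.+1))%:C%C * (cis (ang k) * cis theta ^+ i.+1).
  move: (cis (ang k)) (cis theta) => u v.
  rewrite rmorphM rmorphMn rmorphXn /= exprMn exprS !mulrnAr !mulrnAl.
  by congr (_ *+ _); ring.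
by rewrite Im_scale cis_ang /= mulrAC.
Qed.

Context (lo hi : 'I_n.+1 -> R).

(** The index is a natural number, so consecutive vertices need no wrap-around. *)
Definition circ_coef k (i : 'I_n.+1) : R :=
  if circ_sign q (k + i * p) then hi i else lo i.

Lemma circ_coef_mod k : circ_coef (k %% (2 * q)) = circ_coef k.
Proof. by apply/funext => i; rewrite /circ_coef circ_sign_mod. Qed.

Lemma circ_coef_box k : (forall i, lo i <= hi i) ->
  forall i, circ_coef k i \in `[lo i, hi i].
Proof. by move=> lohi i; rewrite /circ_coef in_itv /=; case: ifP; rewrite lexx lohi. Qed.

(** The support function of the polygon in the direction indexed by [k], as [edge_poly_le_support]
    shows. *)
Definition support_poly k := edge_poly k (circ_coef k).

Lemma support_poly_mod k : support_poly (k %% (2 * q)) = support_poly k.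
Proof.
rewrite /support_poly circ_coef_mod; apply: eq_bigr => i _.
congr (_ * _ *: _); rewrite -sin_ang_mod // modnDml sin_ang_mod //.
Qed.

(** Vertices [k] and [k.+1] differ only in coefficients whose sine factor is zero, so both attain
    the support in direction [k.+1]: they span an edge. *)
Lemma support_polyS k : support_poly k.+1 = edge_poly k.+1 (circ_coef k).
Proof.
apply: eq_bigr => i _; congr (_ *: _).
rewrite /circ_coef addSn.
have [->//|s] := eqVneq (circ_sign q (k + i * p)) (circ_sign q (k + i * p).+1).
by rewrite circ_sign_step // !mulr0.
Qed.

Lemma edge_poly_le_support k a rho : 0 <= rho ->
  (forall i, a i \in `[lo i, hi i]) -> (edge_poly k a).[rho] <= (support_poly k).[rho].
Proof.
move=> rho0 a_box; rewrite !horner_sum ler_sum // => i _.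
rewrite !hornerZ hornerXn ler_wpM2r ?exprn_ge0 // /circ_coef.
move: (a_box i); rewrite in_itv /= => /andP[a1 a2]; case: ifPn => s.
  by rewrite ler_wpM2r // circ_sign_ge0.
by rewrite ler_wnM2r // circ_sign_le0.
Qed.

Context (circ_lead : forall k, circ_coef k ord_max != 0).
Context (n_gt0 : (0 < n)%N).
Context (circ_stable : forall k,
  all_roots_in [set z | 0 < ray_side theta z] (poly_of_coefs (circ_coef k))).

(* Otherwise [0] is interior to the edge joining the values of two consecutive
   vertices; both phases increase with [rho], so the component normal to the
   edge, which the two vertices share, would have both a positive and a
   negative derivative. *)
Lemma support_poly_no_touch k rho : 0 <= rho ->
  (forall j, 0 <= (support_poly j).[rho]) -> (support_poly k.+1).[rho] <> 0.
Proof.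
move=> rho0 h_ge0 hk.
have phase j :
    0 < Re (cis (ang k.+1) * (cplx (circ_coef j)).[rho%:C%C * cis theta]) *
      (edge_poly k.+1 (circ_coef j))^`().[rho] \/
    (edge_poly k.+1 (circ_coef j)).[rho] <> 0.
  have fs : (1 < size (poly_of_coefs (circ_coef j)))%N by rewrite size_poly_of_coefs.
  have [_] := phase_increasing theta rho _ fs (circ_stable j).
  rewrite horner_edge_poly horner_deriv_edge_poly.
  set G' := _^`().[_]; set G := _.[_]; set w := cis (ang k.+1) => v0.
  have w1 : Re w ^+ 2 + Im w ^+ 2 = 1 by exact: cos2Dsin2.
  have [w0|/eqP w0] := eqVneq (Im (w * G)) 0; last by right.
  left; suff -> : Re (w * G) * Im (w * (cis theta * G')) = Im (cis theta * G' * G^*%C) by [].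
  have -> : Im (cis theta * G' * G^*%C) =
      (Re w ^+ 2 + Im w ^+ 2) * Im (cis theta * G' * G^*%C) by rewrite w1 mul1r.
  (* When the normal component [Im (w * G)] vanishes, increasing phase means that the tangential
     component and the derivative of the normal one have the same sign. *)
  have -> : (Re w ^+ 2 + Im w ^+ 2) * Im (cis theta * G' * G^*%C) =
      Re (w * G) * Im (w * (cis theta * G')) - Im (w * G) * Re (w * (cis theta * G')).
    by move: (cis theta * G') => u; rewrite !complex_partE; ring.
  by rewrite w0 mul0r subr0.
have hE : support_poly k.+1 = edge_poly k.+1 (circ_coef k) := support_polyS k.
have s1 := sin_ang1_gt0 _ q_gt1 : 0 < sin (ang 1).
case: (phase k.+1) => [|]; last by [].
case: (phase k) => [|]; last by rewrite -hE.
rewrite -hE -/(support_poly k.+1).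
have Gk : Im (cis (ang k.+1) * (cplx (circ_coef k)).[rho%:C%C * cis theta]) = 0.
  by rewrite -horner_edge_poly -hE.
have Gk1 : Im (cis (ang k.+1) * (cplx (circ_coef k.+1)).[rho%:C%C * cis theta]) = 0.
  by rewrite -horner_edge_poly.
(* The supports on either side of the edge force the tangential components of the two vertices to
   have opposite weak signs, while the derivative [d] is common to both. *)
have := h_ge0 k; have := h_ge0 k.+2.
rewrite support_polyS [support_poly k]/support_poly !horner_edge_poly.
move: Gk Gk1; set G := _.[_]; set G1 := (cplx (circ_coef k.+1)).[_] => Gk Gk1.
have -> : cis (ang k.+2) = cis (ang 1) * cis (ang k.+1) by rewrite -cisD -angD.
have -> : cis (ang k) = cis (- ang 1) * cis (ang k.+1).
  by rewrite -cisD -[k.+1]addn1 angD addrC addrK.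
rewrite -!mulrA ![Im (cis (ang 1) * _)]Im_mul [Im (cis (- ang 1) * _)]Im_mul Gk Gk1.
rewrite !mulr0 !add0r /= sinN mulNr oppr_ge0 (pmulr_rge0 _ s1) (pmulr_rle0 _ s1).
move: (Re _) (Re _) => x y; set d := _.[_] => y0 x0 xd yd.
have [d0|d0] := leP d 0; nra.
Qed.

(** A root makes every support nonnegative at [rho], while at [0] some support is negative because
    the constant terms avoid zero. A contact must then occur, which [support_poly_no_touch]
    excludes. *)
Lemma box_no_boundary_root a rho : 0 <= rho ->
  0 < lo ord0 * hi ord0 -> (forall i, a i \in `[lo i, hi i]) ->
  ~~ root (cplx a) (rho%:C%C * cis theta).
Proof.
move=> rho0 lohi0 a_box; apply/negP => /rootP a_root.
have h_ge0 k : 0 <= (support_poly k).[rho].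
  have := edge_poly_le_support k a rho rho0 a_box.
  by rewrite horner_edge_poly a_root mulr0.
have h0 k : (support_poly k).[0] = circ_coef k ord0 * sin (ang k).
  rewrite horner_sum big_ord_recl big1 ?addr0 /= => [|i _].
    by rewrite hornerZ hornerXn expr0 mulr1 mul0n addn0.
  by rewrite hornerZ hornerXn expr0n mulr0.
have [|x [x0 hx [j hj]]] := @poly_touch_zero R _
    (fun j : 'I_(2 * q) => support_poly j) 0 rho rho0 (fun j => h_ge0 j).
  have q2 : (1 < 2 * q)%N by lia.
  have q1 : (q.+1 < 2 * q)%N by lia.
  have := sin_ang1_gt0 _ q_gt1 : 0 < sin (ang 1).
  (* Directions [1] and [q.+1] are opposite and select [hi ord0] and [lo ord0]; the sign of the
     constant terms decides which support is negative. *)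
  have [hi0|hi0] := ltP (hi ord0) 0.
    exists (Ordinal q2); rewrite h0 /circ_coef /= mul0n addn0 circ_sign1 //.
    by rewrite pmulr_llt0.
  exists (Ordinal q1); rewrite h0 /circ_coef /= mul0n addn0 circ_signq1 //.
  by rewrite -add1n sin_angDq // mulrN oppr_lt0 pmulr_lgt0 //; nra.
have hx' k : 0 <= (support_poly k).[x].
  have k2q : (k %% (2 * q) < 2 * q)%N by rewrite ltn_mod; lia.
  by have := hx (Ordinal k2q); rewrite /= support_poly_mod.
(* Adding a full period gives [j] a predecessor even when [j = 0]. *)
apply: (support_poly_no_touch (j + 2 * q).-1 x x0 hx').
by rewrite prednK; [rewrite -support_poly_mod modnDr support_poly_mod | lia].
Qed.

End ValuePolygon.

(** * Boundary and real points of the sector, and the final assembly *)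

Lemma left_sectorE {R : realType} (p q : nat) (t : R) :
  t = p%:R * pi / q%:R -> pi / 2 <= t < pi -> @left_sector R p q = sector t.
Proof.
move=> tE t_bounds; apply/seteqP; rewrite /left_sector -tE.
by split => z /(sector_ray_sides _ _ t_bounds).
Qed.

Lemma root_conjc {R : realType} (f : {poly R}) (z : R[i]) :
  root (map_poly (real_complex R) f) z^*%C = root (map_poly (real_complex R) f) z.
Proof.
rewrite -complex_root_conj -map_poly_comp; congr root.
by apply: eq_map_poly => x; apply: complex_eq => /=; rewrite ?oppr0.
Qed.

Lemma ray_side_eq0 {R : realType} (t : R) (z : R[i]) :
  ray_side t z = 0 -> z = (cos t * Re z + sin t * Im z)%:C%C * cis t.
Proof.
rewrite /ray_side => z0; have := cos2Dsin2 t; move: z0.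
set c := cos t; set s := sin t => z0 cs.
apply: complex_eq; rewrite !complex_partE /= -/c -/s ?mul0r ?subr0 ?addr0.
  by rewrite -[LHS]mul1r -cs -[LHS]addr0 -(mulr0 s) -z0; ring.
by rewrite -[LHS]mul1r -cs -[LHS]subr0 -(mulr0 c) -z0; ring.
Qed.

(* At [t = pi / 2] the two boundary rays are aligned, so that [ray_side t z = 0]
   also allows [z] to lie on the conjugate ray. *)
Lemma ray_side_boundary {R : realType} (t : R) (z : R[i]) : pi / 2 <= t < pi ->
  ray_side t z = 0 -> 0 <= ray_side t z^*%C ->
  exists2 rho, 0 <= rho & z = rho%:C%C * cis t \/ z^*%C = rho%:C%C * cis t.
Proof.
move=> /andP[t1 t2] z0 z1; have pi0 := pi_gt0 R.
have s0 : 0 < sin t by apply: sin_gt0_pi; apply/andP; split; lra.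
have c0 : cos t <= 0.
  have : 0 <= sin (t - pi / 2) by apply: sin_ge0_pi; apply/andP; split; lra.
  by rewrite sinBpihalf oppr_ge0.
have zE := ray_side_eq0 _ _ z0; set rho := _ + _ in zE.
have [rho0|rho0] := leP 0 rho; first by exists rho => //; left.
have ct : cos t = 0.
  apply/eqP; rewrite eq_le c0 /=.
  have rs0 : 0 < - rho * sin t by rewrite mulr_gt0 // oppr_gt0.
  rewrite -(pmulr_lge0 _ rs0).
  by move: z1; rewrite zE /ray_side !complex_partE /=; lra.
exists (- rho); first by rewrite oppr_ge0 ltW.
by right; rewrite zE; apply: complex_eq; rewrite !complex_partE /= ct; ring.
Qed.

Lemma sector_real_neg {R : realType} (t x : R) : 0 < sin t -> sector t x%:C%C -> x < 0.
Proof.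
by move=> s0 [+ _]; rewrite /ray_side /= mulr0 sub0r oppr_gt0 pmulr_rlt0.
Qed.

(** Real points of the sector are negative, so [f] has no root on the nonnegative half-line and
    keeps there its sign at infinity. *)
Lemma sector_sgr0 {R : realType} (t : R) (f : {poly R}) : 0 < sin t ->
  all_roots_in (sector t) f -> Num.sg f.[0] = Num.sg (lead_coef f).
Proof.
move=> s0 fS; apply: (@sgp_pinftyP R 0 f) => [x|]; last first.
  by rewrite in_itv /= lexx.
rewrite in_itv /= andbT => x0; apply/negP => fx.
have : x < 0; last by rewrite ltNge x0.
by apply: (sector_real_neg t x s0); apply: fS; rewrite fmorph_root.
Qed.

Theorem mainTheorem1 (R : realType) (p q n : nat) (lo hi : 'I_n.+1 -> R)
  (hp : (0 < p)%N) (hq : (0 < q)%N) (hpq : coprime p q)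
  (hratio : 2^-1 <= p%:R / q%:R :> R) (hratio1 : p%:R / q%:R < 1 :> R)
  (hn : (1 <= n)%N)
  (hlohi : forall i, lo i <= hi i)
  (hlead : 0 \notin `[lo ord_max, hi ord_max]) :
  critical_vertices (@left_sector R p q) lo hi
    (@circ_vertex R n lo hi p q).
Proof.
have pi0 := pi_gt0 R.
have tE : p%:R * pi / q%:R = p%:R / q%:R * pi :> R by rewrite mulrAC.
pose t : R := p%:R * pi / q%:R.
have t_bounds : pi / 2 <= t < pi by rewrite /t tE; apply/andP; split; nra.
have q1 : (1 < q)%N.
  move: hratio1; rewrite ltr_pdivrMr ?ltr0n // mul1r ltr_nat; lia.
split; first by move=> m; eexists.
split => [K_in m|v_in].
  apply: K_in; exists (circ_coef p q n lo hi m) => //.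
  by move=> i; exact: circ_coef_box.
rewrite (left_sectorE p q t erefl t_bounds) in v_in *.
have s0 : 0 < sin t by apply: sin_gt0_pi; lra.
have circ_in k : all_roots_in (sector t) (poly_of_coefs (circ_coef p q n lo hi k)).
  have k2q : (k %% (2 * q) < 2 * q)%N by rewrite ltn_mod; lia.
  by rewrite -circ_coef_mod; exact: (v_in (Ordinal k2q)).
have lead_sg : 0 < lo ord_max \/ hi ord_max < 0.
  move: hlead; rewrite in_itv /= negb_and -!ltNge => /orP[]; by [left|right].
have box_lead (c : 'I_n.+1 -> R) : (forall i, c i \in `[lo i, hi i]) ->
    Num.min `|lo ord_max| `|hi ord_max| <= `|c ord_max| /\
    Num.sg (c ord_max) = Num.sg (lo ord_max).
  move=> /(_ ord_max); rewrite in_itv /= => /andP[c1 c2].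
  rewrite ge_min; case: lead_sg => l0.
    have c0 := lt_le_trans l0 c1; have hi0 := lt_le_trans c0 c2.
    by rewrite !gtr0_norm // c1 !gtr0_sg.
  have c0 := le_lt_trans c2 l0.
  have lo0 := le_lt_trans c1 c0.
  by rewrite !ltr0_norm // !lerN2 c2 orbT !ltr0_sg.
have box_lead0 (c : 'I_n.+1 -> R) : (forall i, c i \in `[lo i, hi i]) -> c ord_max != 0.
  move=> /box_lead[_] /eqP; apply: contraTneq => ->.
  rewrite sgr0 eq_sym sgr_eq0; case: lead_sg => l0; first by rewrite gt_eqF.
  by rewrite lt_eqF // (le_lt_trans (hlohi _)).
have lo_box i : lo i \in `[lo i, hi i] by rewrite in_itv /= lexx hlohi.
have hi_box i : hi i \in `[lo i, hi i] by rewrite in_itv /= lexx hlohi.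
have circ_box k := circ_coef_box p q n lo hi k hlohi.
have circ0 k : Num.sg (circ_coef p q n lo hi k ord0) = Num.sg (lo ord_max).
  have := sector_sgr0 t _ s0 (circ_in k).
  rewrite lead_coef_poly_of_coefs; last exact: box_lead0 (circ_box k).
  rewrite (proj2 (box_lead _ (circ_box k))) => <-.
  by rewrite horner_coef0 -(coef_poly_of_coefs _ ord0).
(* Starting points [1] and [q.+1] have constant terms [hi ord0] and [lo ord0], both with the sign of
   the leading coefficients. *)
have lohi0 : 0 < lo ord0 * hi ord0.
  have := circ0 q.+1; have := circ0 1%N.
  rewrite /circ_coef /= mul0n !addn0 circ_sign1 // circ_signq1 // => h1 h2.
  rewrite -sgr_gt0 sgrM h1 h2 -expr2 exprn_even_gt0 // sgr_eq0.
  by rewrite box_lead0.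
have no_root (c : 'I_n.+1 -> R) (rho : R) : (forall i, c i \in `[lo i, hi i]) -> 0 <= rho ->
    ~~ root (map_poly (real_complex R) (poly_of_coefs c)) (rho%:C%C * cis t).
  move=> c_box rho0.
  apply: (box_no_boundary_root p q n q1 lo hi _ hn _ c rho rho0 lohi0 c_box) => //.
    by move=> k; exact: box_lead0 (circ_box k).
  by move=> k z /(circ_in k)[].
move=> _ [a a_box <-].
(* Any critical vertex can start the homotopy; the segment from it to [a] stays in the box. *)
pose b := circ_coef p q n lo hi 0.
have c_box (x : R) : x \in `[0, 1] ->
    forall i, (1 - x) * b i + x * a i \in `[lo i, hi i].
  rewrite !in_itv /= => /andP[x0 x1] i; have := a_box i; have := circ_box 0%N i.
  by rewrite -/b !in_itv /= => /andP[? ?] /andP[? ?]; apply/andP; split; nra.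
apply: (@all_roots_in_homotopy R t n a b (Num.min `|lo ord_max| `|hi ord_max|)).
- by rewrite lt_min !normr_gt0 !box_lead0.
- by move=> x /c_box /box_lead[].
- move=> x z x01 z_root z1 z2.
  (* A vanishing side puts the root on the ray or on its conjugate; real coefficients bring it back
     to the ray covered by [no_root]. *)
  have contra_bd w : root (map_poly (real_complex R)
      (poly_of_coefs (fun i => (1 - x) * b i + x * a i))) w ->
      ray_side t w = 0 -> 0 <= ray_side t w^*%C -> False.
    move=> w_root w1 w2; have [rho rho0 wE] := ray_side_boundary t w t_bounds w1 w2.
    have /negP := no_root _ _ (c_box x x01) rho0; apply.
    by case: wE => <- //; rewrite root_conjc.
  split; rewrite lt_neqAle ?z1 ?z2 andbT eq_sym; apply/eqP => z0.
    exact: contra_bd z_root z0 z2.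
  by apply: (contra_bd z^*%C); rewrite ?root_conjc // conjcK.
- exact: circ_in.
Qed.
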